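(* Let $n\geqslant4$ and let $\mathfrak{s}_{4,n+2}$ be the $(n+2)$-dimensional complex Lie algebra with basis $e_1,\ldots,e_{n+2}$ and non-zero commutation relations \[ [e_k,e_n]=e_{k-1},\ k=2,\ldots,n-1,\qquad [e_n,e_{n+1}]=e_n, \] \[ [e_k,e_{n+1}]=(n-k-1)e_k,\qquad [e_k,e_{n+2}]=e_k,\qquad k=1,\ldots,n-1. \] Put $\xi_k=\sum_{j=1}^k\frac{(-1)^{k-j}}{(k-j)!}e_1^{j-2}e_2^{k-j}e_j$ for $k=3,\ldots,n-1$. Then a complete set of generalized Casimir operators of $\mathfrak{s}_{4,n+2}$ (a basis of $\mathrm{Inv}(\mathfrak{s}_{4,n+2})$) is formed by the $n-4$ expressions \[ \frac{\xi_k^2}{\xi_3^{k-1}},\qquad k=4,\ldots,n-1. \]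
   Context: For a finite-dimensional complex Lie algebra $\mathfrak{g}$ with basis $e_1,\ldots,e_N$, $[e_i,e_j]=c_{ij}^ke_k$, let $x_1,\ldots,x_N$ be the coordinates on $\mathfrak{g}^*$ associated with the dual basis. An invariant of the coadjoint action is a (possibly only locally defined, on a connected open set) analytic function $F(x_1,\ldots,x_N)$ invariant under the coadjoint action, equivalently $\sum_{j,k}c_{ij}^kx_k\,\partial F/\partial x_j=0$ for all $i$. The maximal number of functionally independent invariants is $N_\mathfrak{g}=\dim\mathfrak{g}-\sup_x\operatorname{rank}(\sum_k c_{ij}^kx_k)_{i,j}$. A basis (complete set) of invariants is a set of $N_\mathfrak{g}$ functionally independent invariants (every invariant is then locally a function of them; if $N_\mathfrak{g}=0$ the basis is empty). Elements of $\mathrm{Inv}(\mathfrak{g})$ (generalized Casimir operators) are obtained from invariants by replacing $x_i$ by $e_i$ (with symmetrization of non-commuting products); here only the mutually commuting elements $e_1,\ldots,e_{n-1}$ occur, so $e_i$ may simply be read as the coordinate $x_i$. *)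

(* Defs.v *)
From HB Require Import structures.
From mathcomp Require Import all_boot all_order all_algebra.
From mathcomp Require Import all_classical all_reals all_analysis.
From mathcomp Require Import complex zify ring.
Import Order.TTheory GRing.Theory Num.Theory.
Import numFieldNormedType.Exports.

Set Implicit Arguments.
Unset Strict Implicit.
Unset Printing Implicit Defensive.

Local Open Scope classical_set_scope.
Local Open Scope ring_scope.

(* [R[i]] seen through its structure of closed field, so that the topology and
   norm that MathComp-Analysis puts on every [numFieldType] are inferred on it
   and on the spaces ['rV[cplx R]_n]. *)
Definition cplx (R : realType) : numClosedFieldType := R[i].

(* A Lie algebra of dimension [N] with a chosen basis: the underlying space is
   [K^N] and the basis is the standard one. *)
Record lieAlgebra (K : fieldType) (N : nat) := LieAlgebra {
  lie_bracket : 'rV[K]_N -> 'rV[K]_N -> 'rV[K]_N;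
  lie_bracket_linearl : forall a x y z,
    lie_bracket (a *: x + y) z = a *: lie_bracket x z + lie_bracket y z;
  lie_bracket_linearr : forall a x y z,
    lie_bracket x (a *: y + z) = a *: lie_bracket x y + lie_bracket x z;
  lie_bracket_alt : forall x, lie_bracket x x = 0;
  lie_jacobi : forall x y z,
    lie_bracket (lie_bracket x y) z + lie_bracket (lie_bracket y z) x
      + lie_bracket (lie_bracket z x) y = 0
}.

(* [c_ij^k] *)
Definition struct_const (K : fieldType) (N : nat) (g : lieAlgebra K N)
    (i j k : 'I_N) : K :=
  lie_bracket g (delta_mx 0 i) (delta_mx 0 j) 0 k.

(* The matrix with entries [\sum_k c_ij^k x_k], where [x : 'rV_N] is the row of
   coordinates of a point of the dual space. *)
Definition coadjoint_mx (K : fieldType) (N : nat) (g : lieAlgebra K N)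
    (x : 'rV[K]_N) : 'M[K]_N :=
  \matrix_(i, j) \sum_k struct_const g i j k * x 0 k.

(* [N - sup_x rank (coadjoint_mx g x)]; ranks are at most [N], so the supremum
   is the largest [r <= N] which is the rank at some point. *)
Definition num_invariants (K : fieldType) (N : nat) (g : lieAlgebra K N) : nat :=
  (N - \max_(r < N.+1 | `[< exists x, \rank (coadjoint_mx g x) = r >]) r)%N.

Section Invariants.
Variable R : realType.
Local Notation C := (cplx R).

(* [differentiable] over the field [C] is complex (Frechet) differentiability,
   so on an open set this is analyticity. *)
Definition holomorphic_on (N : nat) (U : set 'rV[C]_N) (F : 'rV[C]_N -> C) :=
  open U /\ forall x, U x -> differentiable F x.

Definition coadjoint_invariant (N : nat) (g : lieAlgebra C N)
    (U : set 'rV[C]_N) (F : 'rV[C]_N -> C) :=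
  holomorphic_on U F /\
  forall x, U x -> forall i : 'I_N,
    \sum_j (\sum_k struct_const g i j k * x 0 k) * 'D_(delta_mx 0 j) F x = 0.

(* The [F i] satisfy, on [W], an analytic relation [Phi (F 0, .., F (m-1)) = 0]
   with [Phi] not identically zero on any nonempty open set. *)
Definition functionally_dependent (N m : nat) (W : set 'rV[C]_N)
    (F : 'I_m -> 'rV[C]_N -> C) :=
  exists (V : set 'rV[C]_m) (Phi : 'rV[C]_m -> C),
    [/\ holomorphic_on V Phi,
        forall O, open O -> O !=set0 -> O `<=` V ->
          exists2 z, O z & Phi z != 0 &
        forall x, W x ->
          V (\row_i F i x) /\ Phi (\row_i F i x) = 0].

Definition functionally_independent (N m : nat) (U : set 'rV[C]_N)
    (F : 'I_m -> 'rV[C]_N -> C) :=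
  forall W, open W -> W !=set0 -> W `<=` U -> ~ functionally_dependent W F.

(* [F] is a complete set of invariants of [g], all defined on the connected
   open set [U]. *)
Definition invariant_basis (N m : nat) (g : lieAlgebra C N)
    (U : set 'rV[C]_N) (F : 'I_m -> 'rV[C]_N -> C) :=
  [/\ [/\ open U, connected U & U !=set0],
      m = num_invariants g,
      forall i, coadjoint_invariant g U (F i) &
      functionally_independent U F].

End Invariants.

Section S4.
Variables (K : fieldType) (n : nat).

(* [e_p] and [x_p] for the 1-based labels [p = 1, .., n + 2]. *)
Definition basis_elt (p : nat) : 'rV[K]_n.+2 := delta_mx 0 (inord p.-1).
Definition coord_at (x : 'rV[K]_n.+2) (p : nat) : K := x 0 (inord p.-1).

(* The listed commutation relations [[e_p, e_q]], with [p < q]. *)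
Definition s4_rel (p q : nat) : 'rV[K]_n.+2 :=
  if [&& 2 <= p, p <= n - 1 & q == n]%N then basis_elt p.-1
  else if [&& p == n & q == n.+1]%N then basis_elt n
  else if [&& 1 <= p, p <= n - 1 & q == n.+1]%N then (n - p - 1)%N%:R *: basis_elt p
  else if [&& 1 <= p, p <= n - 1 & q == n.+2]%N then basis_elt p
  else 0.

(* [s4_rel q p] vanishes whenever [s4_rel p q] does not, so the difference is
   the antisymmetric extension of the listed relations. *)
Definition s4_bracket (x y : 'rV[K]_n.+2) : 'rV[K]_n.+2 :=
  \sum_(i < n.+2) \sum_(j < n.+2)
    (x 0 i * y 0 j) *: (s4_rel i.+1 j.+1 - s4_rel j.+1 i.+1).

Lemma s4_bracket_linearl a x y z :
  s4_bracket (a *: x + y) z = a *: s4_bracket x z + s4_bracket y z.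
Proof.
rewrite /s4_bracket scaler_sumr -big_split; apply: eq_bigr => i _.
rewrite scaler_sumr -big_split; apply: eq_bigr => j _ /=.
by rewrite !mxE mulrDl scalerDl scalerA mulrA.
Qed.

Lemma s4_bracket_anti x y : s4_bracket x y = - s4_bracket y x.
Proof.
rewrite /s4_bracket exchange_big -sumrN; apply: eq_bigr => i _.
rewrite -sumrN; apply: eq_bigr => j _ /=.
by rewrite -scalerN opprB mulrC.
Qed.

Lemma s4_bracket_linearr a x y z :
  s4_bracket x (a *: y + z) = a *: s4_bracket x y + s4_bracket x z.
Proof.
by rewrite s4_bracket_anti s4_bracket_linearl opprD -scalerN -!(s4_bracket_anti x).
Qed.

Let half (x y : 'rV[K]_n.+2) : 'rV[K]_n.+2 :=
  \sum_(i < n.+2) \sum_(j < n.+2) (x 0 i * y 0 j) *: s4_rel i.+1 j.+1.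

Let bracket_half x y : s4_bracket x y = half x y - half y x.
Proof.
rewrite /half [X in _ - X]exchange_big -sumrB; apply: eq_bigr => i _.
rewrite -sumrB; apply: eq_bigr => j _.
by rewrite scalerBr [y 0 j * _]mulrC.
Qed.

Lemma s4_bracket_alt x : s4_bracket x x = 0.
Proof. by rewrite bracket_half subrr. Qed.

Let term (x y : 'rV[K]_n.+2) (a b : nat) (i j : 'I_n.+2) : K :=
  (x 0 i * y 0 j) * ((i.+1 == a) && (j.+1 == b))%:R.

Let sum2 (a b : nat) (x y : 'rV[K]_n.+2) : (0 < a <= n.+2)%N -> (0 < b <= n.+2)%N ->
  \sum_(i < n.+2) \sum_(j < n.+2) term x y a b i j
  = coord_at x a * coord_at y b.
Proof.
rewrite /term => ha hb.
have ia : ((inord a.-1 : 'I_n.+2) : nat).+1 = a by rewrite inordK; lia.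
have ib : ((inord b.-1 : 'I_n.+2) : nat).+1 = b by rewrite inordK; lia.
rewrite (bigD1 (inord a.-1)) //= [X in _ + X]big1 ?addr0; last first.
  move=> i /eqP hi; apply: big1 => j _.
  case: eqP => [e|]; last by rewrite mulr0.
  by case: hi; apply/val_inj; apply: succn_inj; rewrite ia.
rewrite (bigD1 (inord b.-1)) //= [X in _ + X]big1 ?addr0; last first.
  move=> i /eqP hi; rewrite andbC.
  case: eqP => [e|]; last by rewrite mulr0.
  by case: hi; apply/val_inj; apply: succn_inj; rewrite ib.
by rewrite ia ib !eqxx mulr1.
Qed.

Let elt_at (p q : nat) : (0 < p <= n.+2)%N -> (0 < q <= n.+2)%N ->
  basis_elt p 0 (inord q.-1) = (p == q)%:R.
Proof.
move=> hp hq; rewrite mxE eqxx /=; congr (nat_of_bool _)%:R.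
rewrite -val_eqE /= !inordK; lia.
Qed.

Let rel_at (i j p : nat) (b1 b2 b3 b4 : bool) :
  (0 < i <= n.+2)%N -> (0 < j <= n.+2)%N -> (0 < p <= n.+2)%N ->
  b1 = [&& p.+1 < n, i == p.+1 & j == n]%N ->
  b2 = [&& p == n, 0 < n, i == n & j == n.+1]%N ->
  b3 = [&& p < n, i == p & j == n.+1]%N ->
  b4 = [&& p < n, i == p & j == n.+2]%N ->
  s4_rel i j 0 (inord p.-1)
  = b1%:R + b2%:R + b3%:R * (n - p - 1)%N%:R + b4%:R.
Proof.
move=> hi hj hp e1 e2 e3 e4; rewrite /s4_rel.
case: ifP => h1.
  rewrite elt_at; [|lia|lia].
  have -> : b2 = false by lia.
  have -> : b3 = false by lia.
  have -> : b4 = false by lia.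
  by rewrite mul0r !addr0; congr (nat_of_bool _)%:R; lia.
have -> : b1 = false by lia.
case: ifP => h2.
  rewrite elt_at; [|lia|lia].
  have -> : b3 = false by lia.
  have -> : b4 = false by lia.
  by rewrite mul0r !addr0 add0r; congr (nat_of_bool _)%:R; lia.
have -> : b2 = false by lia.
case: ifP => h3.
  rewrite mxE elt_at; [|lia|lia].
  have -> : b4 = false by lia.
  have -> : b3 = (i == p)%N by lia.
  by case: eqVneq => [->|_]; rewrite ?mulr1 ?mul1r ?mulr0 ?mul0r !(addr0, add0r).
have -> : b3 = false by lia.
case: ifP => h4.
  rewrite elt_at; [|lia|lia].
  by rewrite mul0r !add0r; congr (nat_of_bool _)%:R; lia.
have -> : b4 = false by lia.
by rewrite mxE mul0r !add0r.
Qed.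

Let half_at (x y : 'rV[K]_n.+2) (p : nat) : (0 < p <= n.+2)%N ->
  coord_at (half x y) p =
    ((p.+1 < n)%N)%:R * (coord_at x p.+1 * coord_at y n)
  + ((p == n) && (0 < n)%N)%:R * (coord_at x n * coord_at y n.+1)
  + ((p < n)%N)%:R * ((n - p - 1)%N%:R * (coord_at x p * coord_at y n.+1)
                     + coord_at x p * coord_at y n.+2).
Proof.
move=> hp.
transitivity (\sum_(i < n.+2) \sum_(j < n.+2) (
   (((p.+1 < n)%N)%:R * term x y p.+1 n i j
  + ((p == n) && (0 < n)%N)%:R * term x y n n.+1 i j)
  + (((p < n)%N)%:R * (n - p - 1)%N%:R * term x y p n.+1 i j
  + ((p < n)%N)%:R * term x y p n.+2 i j))).
  rewrite /coord_at /half summxE; apply: eq_bigr => i _.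
  rewrite summxE; apply: eq_bigr => j _; rewrite mxE.
  rewrite (rel_at (ltn_ord i : (0 < i.+1 <= n.+2)%N) (ltn_ord j : (0 < j.+1 <= n.+2)%N) hp
             erefl erefl erefl erefl).
  by rewrite /term -!mulnb !natrM; ring.
under eq_bigr => i _ do rewrite big_split /= !big_split /= -!mulr_sumr.
rewrite big_split /= !big_split /= -!mulr_sumr.
have [n0|npos] : (n = 0 \/ 0 < n)%N by lia.
  have -> : (p.+1 < n)%N = false by lia.
  have -> : ((p == n) && (0 < n))%N = false by lia.
  have -> : (p < n)%N = false by lia.
  by rewrite !mul0r !addr0.
have [h|h] : (p.+1 < n \/ n <= p.+1)%N by lia.
  by rewrite !sum2; try lia; ring.
have -> : (p.+1 < n)%N = false by lia.
by rewrite !mul0r !sum2; try lia; ring.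
Qed.

Let bracket_at (x y : 'rV[K]_n.+2) (p : nat) : (0 < p <= n.+2)%N ->
  coord_at (s4_bracket x y) p = coord_at (half x y) p - coord_at (half y x) p.
Proof. by rewrite bracket_half /coord_at !mxE. Qed.

Lemma s4_jacobi x y z :
  s4_bracket (s4_bracket x y) z + s4_bracket (s4_bracket y z) x
    + s4_bracket (s4_bracket z x) y = 0.
Proof.
apply/rowP => k.
have -> : k = inord k.+1.-1 by rewrite inord_val.
move: (k.+1) (ltn_ord k : (0 < k.+1 <= n.+2)%N) => p hp {k}.
rewrite !mxE -!/(coord_at _ p).
rewrite !(bracket_at _ _ hp) !(half_at _ _ hp).
have [n0|npos] : (n = 0 \/ 0 < n)%N by lia.
  have -> : (p.+1 < n)%N = false by lia.
  have -> : ((p == n) && (0 < n))%N = false by lia.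
  have -> : (p < n)%N = false by lia.
  by rewrite !mul0r; ring.
have hn : (0 < n <= n.+2)%N by lia.
have hn1 : (0 < n.+1 <= n.+2)%N by lia.
have hn2 : (0 < n.+2 <= n.+2)%N by lia.
rewrite !(bracket_at _ _ hn) !(half_at _ _ hn) !(bracket_at _ _ hn1) !(half_at _ _ hn1).
rewrite !(bracket_at _ _ hn2) !(half_at _ _ hn2) !(bracket_at _ _ hp) !(half_at _ _ hp).
have e1 : (n.+1 < n)%N = false by lia.
have e2 : (n.+2 < n)%N = false by lia.
have e3 : (n.+3 < n)%N = false by lia.
have e4 : (n.+1 == n)%N = false by lia.
have e5 : (n.+2 == n)%N = false by lia.
rewrite eqxx npos ltnn e1 e2 e3 e4 e5 !andbT.
have tE : true%:R = 1 :> K by [].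
have fE : false%:R = 0 :> K by [].
have [h1|[h1|[h1|h1]]] : (p.+1 < n \/ p.+1 = n \/ p = n \/ n < p)%N by lia.
- have hp1 : (0 < p.+1 <= n.+2)%N by lia.
  rewrite !(bracket_at _ _ hp1) !(half_at _ _ hp1) h1.
  have -> : (p < n)%N by lia.
  have -> : (p == n)%N = false by lia.
  have -> : (p.+1 == n)%N = false by lia.
  have -> : (n - p - 1 = (n - p.+1 - 1).+1)%N by lia.
  rewrite tE fE -natr1; move: ((p.+2 < n)%N%:R) => t; ring.
- have -> : (p.+1 < n)%N = false by lia.
  have -> : (p < n)%N by lia.
  have -> : (p == n)%N = false by lia.
  by rewrite tE fE; ring.
- rewrite h1 e1 eqxx ltnn tE fE; ring.
- have -> : (p.+1 < n)%N = false by lia.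
  have -> : (p == n)%N = false by lia.
  have -> : (p < n)%N = false by lia.
  by rewrite tE fE; ring.
Qed.

Definition s4 : lieAlgebra K n.+2 :=
  LieAlgebra s4_bracket_linearl s4_bracket_linearr s4_bracket_alt s4_jacobi.

Lemma s4_bracketE (i j : 'I_n.+2) : (i < j)%N ->
  lie_bracket s4 (delta_mx 0 i) (delta_mx 0 j) = s4_rel i.+1 j.+1.
Proof.
move=> ij; rewrite /= /s4_bracket (bigD1 i) //= [X in _ + X]big1 ?addr0; last first.
  move=> k /negPf ki; apply: big1 => l _.
  by rewrite mxE ki mul0r scale0r.
rewrite (bigD1 j) //= [X in _ + X]big1 ?addr0; last first.
  by move=> k /negPf kj; rewrite [X in _ * X]mxE kj mulr0 scale0r.
rewrite !mxE !eqxx mulr1 scale1r [s4_rel j.+1 _]/s4_rel.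
by rewrite !ifF ?subr0 //; have := ltn_ord j; lia.
Qed.

(* [x_1 ^ (j - 2)] has exponent [-1] for [j = 1], whence the restriction to
   [x_1 != 0] in [s4_dom]. *)
Definition xi (k : nat) (x : 'rV[K]_n.+2) : K :=
  \sum_(1 <= j < k.+1)
    (-1) ^+ (k - j) / ((k - j)`!)%:R
    * coord_at x 1 ^ (j%:Z - 2) * coord_at x 2 ^+ (k - j) * coord_at x j.

Definition s4_casimir (k : nat) (x : 'rV[K]_n.+2) : K :=
  xi k x ^+ 2 / xi 3 x ^+ (k - 1).

(* Where all the expressions are defined. *)
Definition s4_dom : set 'rV[K]_n.+2 :=
  [set x | coord_at x 1 != 0 /\ xi 3 x != 0].

End S4.

(* Main.v *)
(* Rank: the coadjoint matrix vanishes on the abelian ideal <e_1, .., e_{n-1}>, so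
   its rank is at most 3 + 3, and 6 is attained at x_1 = x_3 = 1, other x_p = 0.

   Invariance: the derivative along the coadjoint vector of e_n kills every xi_k,
   because the terms cancel pairwise; those of the other basis elements rescale
   xi_k by (k - 1) lambda with lambda independent of k, so the weights of xi_k^2
   and xi_3^(k-1) agree.

   Independence: with x_1, x_2, x_3 fixed, (xi_4, .., xi_{n-1}) is an invertible
   triangular affine function of (x_4, .., x_{n-1}), and squaring is an open map of
   C; so through each point of the domain there is a section of the Casimir map,
   continuous there, and an analytic relation would vanish on an open set.

   Connectedness: the domain is the nonvanishing locus of a polynomial. *)
Require Import Defs.
From mathcomp Require Import all_boot all_order all_algebra.
From mathcomp Require Import all_classical all_reals all_analysis.
From mathcomp Require Import complex zify ring lra.
Import Order.TTheory GRing.Theory Num.Theory.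
Import numFieldNormedType.Exports.

Set Implicit Arguments.
Unset Strict Implicit.
Unset Printing Implicit Defensive.

Local Open Scope classical_set_scope.
Local Open Scope ring_scope.

(** * Rank bounds for matrices with a large zero block, and for submatrices *)

Section RankBound.
Variable K : fieldType.

Lemma rank_rows_supported (m n k : nat) (s : 'I_k -> 'I_m) (A : 'M[K]_(m, n)) :
  (forall i, i \notin codom s -> row i A = 0) -> (\rank A <= k)%N.
Proof.
move=> A0; apply: leq_trans (rank_leq_row (rowsub s A)).
apply/mxrankS/row_subP => i.
have [/codomP[l ->]|/A0->] := boolP (i \in codom s); last exact: sub0mx.
by rewrite -row_rowsub row_sub.
Qed.

(** Split [M] into the rows indexed by [s] and the others: the first part has at most [k] nonzero
    rows, and the second at most [k] nonzero columns. *)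
Lemma rank_zero_block (m k : nat) (s : 'I_k -> 'I_m) (M : 'M[K]_m) :
  (forall i j, i \notin codom s -> j \notin codom s -> M i j = 0) ->
  (\rank M <= k + k)%N.
Proof.
move=> M0.
pose A : 'M[K]_m := \matrix_(i, j) (if i \in codom s then M i j else 0).
pose B : 'M[K]_m := \matrix_(i, j) (if i \in codom s then 0 else M i j).
have -> : M = A + B.
  by apply/matrixP => i j; rewrite !mxE; case: ifP; rewrite ?addr0 ?add0r.
apply: leq_trans (mxrank_add _ _) (leq_add _ _); last rewrite -mxrank_tr.
  by apply: (rank_rows_supported (s := s)) => i /negPf si; apply/rowP => j; rewrite !mxE si.
apply: (rank_rows_supported (s := s)) => i si; apply/rowP => j.
by rewrite !mxE; case: ifP => // /negbT sj; apply: M0.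
Qed.

Lemma rank_mxsub_le (m n p q : nat) (f : 'I_p -> 'I_m) (g : 'I_q -> 'I_n)
    (M : 'M[K]_(m, n)) : (\rank (mxsub f g M) <= \rank M)%N.
Proof.
have rowsub_le a b c (h : 'I_a -> 'I_b) (A : 'M[K]_(b, c)) :
    (\rank (rowsub h A) <= \rank A)%N.
  by apply/mxrankS/row_subP => i; rewrite row_rowsub row_sub.
have -> : mxsub f g M = rowsub f (colsub g M) by apply/matrixP => i j; rewrite !mxE.
apply: leq_trans (rowsub_le _ _ _ _ _) _.
rewrite -mxrank_tr -(mxrank_tr M).
have -> : (colsub g M)^T = rowsub g M^T by apply/matrixP => i j; rewrite !mxE.
exact: rowsub_le.
Qed.

End RankBound.

(** * The maximal rank of the coadjoint matrix *)

Section CoadjointMatrix.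
Variables (K : fieldType) (n : nat).
Implicit Types x y : 'rV[K]_n.+2.

Lemma s4_struct_const (i j k : 'I_n.+2) :
  struct_const (s4 K n) i j k = (s4_rel K n i.+1 j.+1 - s4_rel K n j.+1 i.+1) 0 k.
Proof.
rewrite /struct_const /= /s4_bracket (bigD1 i) //= [X in _ + X]big1 ?addr0.
  rewrite (bigD1 j) //= [X in _ + X]big1 ?addr0.
    by rewrite [delta_mx 0 i 0 i]mxE [delta_mx 0 j 0 j]mxE !eqxx mulr1 scale1r.
  by move=> l /negPf lj; rewrite [X in _ * X]mxE lj mulr0 scale0r.
move=> k' /negPf ki; apply: big1 => l _.
by rewrite [X in X * _]mxE ki mul0r scale0r.
Qed.

Lemma dot_basis_elt x p : \sum_k basis_elt K n p 0 k * x 0 k = coord_at x p.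
Proof.
rewrite (bigD1 (inord p.-1)) //= big1 ?addr0 => [|k /negPf kp].
  by rewrite mxE !eqxx mul1r.
by rewrite mxE kp mul0r.
Qed.

Lemma dot_s4_rel x p q : \sum_k s4_rel K n p q 0 k * x 0 k =
  if [&& 2 <= p, p <= n - 1 & q == n]%N then coord_at x p.-1
  else if [&& p == n & q == n.+1]%N then coord_at x n
  else if [&& 1 <= p, p <= n - 1 & q == n.+1]%N
    then (n - p - 1)%N%:R * coord_at x p
  else if [&& 1 <= p, p <= n - 1 & q == n.+2]%N then coord_at x p
  else 0.
Proof.
rewrite /s4_rel; case: ifP => _; first exact: dot_basis_elt.
case: ifP => _; first exact: dot_basis_elt.
case: ifP => _.
  rewrite -dot_basis_elt mulr_sumr; apply: eq_bigr => k _.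
  by rewrite mxE mulrA.
case: ifP => _; first exact: dot_basis_elt.
by apply: big1 => k _; rewrite mxE mul0r.
Qed.

Lemma s4_coadjointE x (i j : 'I_n.+2) :
  \sum_k struct_const (s4 K n) i j k * x 0 k =
  \sum_k s4_rel K n i.+1 j.+1 0 k * x 0 k - \sum_k s4_rel K n j.+1 i.+1 0 k * x 0 k.
Proof.
rewrite -sumrB; apply: eq_bigr => k _.
by rewrite s4_struct_const 2!mxE mulrBl.
Qed.

Lemma s4_coadjoint0 x (i j : 'I_n.+2) : (i < n - 1)%N -> (j < n - 1)%N ->
  coadjoint_mx (s4 K n) x i j = 0.
Proof.
by move=> hi hj; rewrite mxE s4_coadjointE !dot_s4_rel !ifF ?subr0 //; lia.
Qed.

Lemma rank_coadjoint_le x : (4 <= n)%N -> (\rank (coadjoint_mx (s4 K n) x) <= 6)%N.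
Proof.
(* The image of [s] consists of the 0-based indices of e_n, e_{n+1}, e_{n+2}, the basis elements
   outside the abelian ideal. *)
move=> n4; pose s (l : 'I_3) : 'I_n.+2 := inord (n - 1 + l).
have sP (i : 'I_n.+2) : i \notin codom s -> (i < n - 1)%N.
  apply: contraR => hi; apply/codomP.
  have li : (i - (n - 1) < 3)%N by have := ltn_ord i; lia.
  exists (Ordinal li); apply: ord_inj; have := ltn_ord i.
  by move: hi; rewrite -leqNgt /s /= => hi hi'; rewrite inordK; lia.
by apply: (rank_zero_block (s := s)) => i j /sP hi /sP hj; apply: s4_coadjoint0.
Qed.

(* The columns are numbered from 0: this is x_1 = x_3 = 1. *)
Definition s4_generic_point : 'rV[K]_n.+2 :=
  \row_j ((j == 0%N :> nat) || (j == 2%N :> nat))%:R.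

(** The rows of e_1, e_2, e_3, e_n, e_{n+1}, e_{n+2}, taken against the same columns with the two
    triples exchanged, form a block diagonal matrix with blocks [B] and [- B^T], where [B] is
    invertible of size 3. *)
Lemma rank_coadjoint_generic : (4 <= n)%N -> (2%:R != 0 :> K) ->
  \rank (coadjoint_mx (s4 K n) s4_generic_point) = 6.
Proof.
move=> n4 two; set x := s4_generic_point; set M := coadjoint_mx _ x.
apply/eqP; rewrite eqn_leq rank_coadjoint_le //=.
have xE p : (0 < p <= n.+2)%N -> coord_at x p = ((p == 1%N) || (p == 3%N))%:R.
  by move=> hp; rewrite /coord_at mxE inordK; [congr (_%:R)|]; lia.
pose lo (l : 'I_3) : 'I_n.+2 := inord l.
pose hi (l : 'I_3) : 'I_n.+2 := inord (n - 1 + l).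
pose f (l : 'I_(3 + 3)) := match fintype.split l with inl a => lo a | inr a => hi a end.
pose g (l : 'I_(3 + 3)) := match fintype.split l with inl a => hi a | inr a => lo a end.
apply: leq_trans (rank_mxsub_le f g M).
have loE l : (lo l).+1 = l.+1 by rewrite inordK //; case: l => /=; lia.
have hiE l : (hi l).+1 = (n + l)%N by rewrite inordK; case: l => /=; lia.
pose B : 'M[K]_3 := \matrix_(a, b) M (lo a) (hi b).
have loN l : (lo l < n - 1)%N by rewrite -ltnS loE; case: l => /=; lia.
have ME i j : M i j = \sum_k s4_rel K n i.+1 j.+1 0 k * x 0 k
                    - \sum_k s4_rel K n j.+1 i.+1 0 k * x 0 k.
  by rewrite mxE s4_coadjointE.
(* This kills the contribution of [e_n, e_{n+1}] = e_n, the only nonzero bracket among the last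
   three basis elements. *)
have xn : coord_at x n = 0.
  have n13 : (n == 1%N) || (n == 3%N) = false by lia.
  by rewrite xE ?n13 //; lia.
have BE : mxsub f g M = block_mx B 0 0 (- B^T).
  apply/matrixP => i j; rewrite -(splitK i) -(splitK j) [LHS]mxE /f /g !unsplitK.
  case: (fintype.split i) => a; case: (fintype.split j) => b /=;
    rewrite ?block_mxEul ?block_mxEur ?block_mxEdl ?block_mxEdr.
  - by rewrite [RHS]mxE.
  - by rewrite [RHS]mxE s4_coadjoint0.
  - rewrite [RHS]mxE ME !dot_s4_rel !hiE xn.
    by repeat (case: ifP => ?; try (exfalso; lia)); rewrite ?subrr.
  - by rewrite !mxE !s4_coadjointE opprB.
rewrite BE rank_diag_block_mx mxrank_opp mxrank_tr.
suff -> : \rank B = 3%N by [].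
have BEl a b : B a b = (nth [::] [:: [:: 0; n%:R - 2%:R; 1]; [:: 1; 0; 0];
                           [:: 0; n%:R - 4%:R; 1]] a)`_b.
  have nB k : (k < 3)%N -> (n - k.+1 - 1)%N%:R = n%:R - (k.+2)%:R :> K.
    by move=> k3; rewrite -subnDA addn1 natrB //; lia.
  rewrite mxE ME !dot_s4_rel !loE !hiE.
  case: a b => [[|[|[|//]]] ha] [[|[|[|//]]] hb] //=.
  all: repeat (case: ifP => ?; try (exfalso; lia)).
  all: rewrite ?nB ?xE //= ?mulr0 ?mulr1 ?subr0 //; try lia.
(* Minus the adjugate of [B]. The determinant of [B] is -2, the difference of the weights n - 4 and
   n - 2 of e_3 and e_1 under e_{n+1}; hence the hypothesis [two]. *)
pose B' : 'M[K]_3 := \matrix_(i, j) (nth [::]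
  [:: [:: 0; 2%:R; 0]; [:: 1; 0; -1]; [:: 4%:R - n%:R; 0; n%:R - 2%:R]] i)`_j.
have BB' : B *m B' = 2%:R%:M.
  apply/matrixP => i j; rewrite mxE.
  rewrite !big_ord_recl big_ord0 !BEl !mxE /=.
  case: i j => [[|[|[|//]]] ha] [[|[|[|//]]] hb] //=; ring.
apply/mxrank_unit; suff : B *m ((2%:R)^-1 *: B') = 1%:M by case/mulmx1_unit.
by rewrite -scalemxAr BB' scale_scalar_mx mulVf.
Qed.

Lemma num_invariants_s4 : (4 <= n)%N -> (2%:R != 0 :> K) ->
  num_invariants (s4 K n) = (n - 4)%N.
Proof.
move=> n4 two; rewrite /num_invariants.
suff -> : (\max_(r < n.+3 | `[< exists x, \rank (coadjoint_mx (s4 K n) x) = r >]) r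
  = 6)%N by lia.
have h6 : (6 < n.+3)%N by lia.
apply/eqP; rewrite eqn_leq; apply/andP; split.
  by apply/bigmax_leqP => r /asboolP[x <-]; exact: rank_coadjoint_le.
rewrite -[6%N]/(nat_of_ord (Ordinal h6)).
by apply: (@leq_bigmax_cond _ _ (fun r : 'I_n.+3 => nat_of_ord r)); apply/asboolP;
  exists s4_generic_point; exact: rank_coadjoint_generic.
Qed.

End CoadjointMatrix.

(** * Connectedness of the nonvanishing locus of a polynomial *)

Section Connected.
Variable R : realType.
Local Notation C := (cplx R).

Lemma connected_by_paths (T : topologicalType) (A : set T) :
  (forall x y, A x -> A y ->
     exists g : R -> T, [/\ continuous g, g 0 = x, g 1 = y &
       forall s, 0 <= s <= 1 -> A (g s)]) ->
  connected A.
Proof.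
move=> path.
have [->|/set0P[x Ax]] := eqVneq A set0; first exact: connected0.
suff -> : A = connected_component A x by exact: component_connected.
apply/seteqP; split; last exact: connected_component_sub.
move=> y Ay; have [g [cg g0 g1 gA]] := path x y Ax Ay.
exists (g @` `[0, 1]%classic); last first.
  by exists 1; rewrite //= in_itv /= ler01 lexx.
split.
- by exists 0; rewrite //= in_itv /= lexx ler01.
- by move=> z [s s01 <-]; apply: gA; move: s01; rewrite /= in_itv.
apply: connected_continuous_connected; first exact: segment_connected.
exact: continuous_subspaceT.
Qed.

Lemma continuous_real_complex : continuous (fun s : R => (s%:C)%C : C).
Proof.
move=> s; apply/cvgrPdist_lt => -[a b] /=.
(* In the order of the complex numbers, a positive radius a + ib has b = 0 and a > 0. *)
rewrite ltcE /= => /andP[/eqP -> a0].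
have : \forall t \near s, `|s - t| < a by apply: nbhsx_ballx.
apply: filterS => t st.
rewrite -rmorphB /= normc_def /= expr0n addr0 sqrtr_sqr ltcR.
exact: st.
Qed.

(** Supplies a parameter avoiding the finitely many bad values; the witness exceeds every element of
    [s]. *)
Lemma fresh_real (s : seq R) : exists r, r \notin s.
Proof.
exists (1 + \sum_(a <- s) `|a|); set S := \sum_(a <- s) `|a|; apply/negP => sP.
have := ler_norm (1 + S); rewrite leNgt => /negP; apply.
have : S = `|1 + S| + \sum_(a <- rem (1 + S) s) `|a| by rewrite {1}/S (big_rem _ sP).
have : 0 <= \sum_(a <- rem (1 + S) s) `|a| by apply: sumr_ge0.
lra.
Qed.

(* Two points of the set are joined inside the complex line through them, along
   the parabola s + i r s (1 - s): every root lies on at most one of these, so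
   all but finitely many r will do. *)
Lemma connected_nonzero_polynomial (N : nat) (f : 'rV[C]_N -> C) :
  (forall x d, exists p : {poly C}, forall t, f (x + t *: d) = p.[t]) ->
  connected [set x | f x != 0].
Proof.
move=> fp; apply: connected_by_paths => x y /= fx fy.
have [p pE] := fp x (y - x).
have px : f x = p.[0] by rewrite -pE scale0r addr0.
have py : f y = p.[1] by rewrite -pE scale1r addrC subrK.
have p0 : p != 0 by apply: contraNneq fx => p0; rewrite px p0 horner0.
have [rs prs] := closed_field_poly_normal p.
have pN0 t : (p.[t] != 0) = (t \notin rs).
  by rewrite prs hornerZ mulf_eq0 lead_coef_eq0 (negPf p0) -rootE root_prod_XsubC.
(* The listed value is the parameter whose parabola passes through the root z. If Re z is 0 or 1 it
   is a meaningless default, but such a root could only be met at an endpoint, where f is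
   nonzero. *)
have [r rP] := fresh_real
  [seq complex.Im z / (complex.Re z * (1 - complex.Re z)) | z <- rs].
pose q (s : R) := r * (s * (1 - s)).
pose c (s : R) : C := (s%:C)%C + 'i%C * ((q s)%:C)%C.
have cE s : c s = Complex s (q s) by rewrite [RHS]complexE.
have c0 : c 0 = 0 by rewrite cE /q mul0r mulr0.
have c1 : c 1 = 1 by rewrite cE /q subrr !mulr0.
have cq : continuous q.
  move=> s; apply: cvgM; first exact: cvg_cst.
  apply: cvgM; first exact: cvg_id.
  by apply: cvgB; [exact: cvg_cst | exact: cvg_id].
have cqC : continuous (fun s : R => ((q s)%:C)%C : C).
  by move=> s; apply: continuous_comp; [exact: cq | exact: continuous_real_complex].
have cc : continuous c.
  move=> s; apply: cvgD; first exact: continuous_real_complex.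
  by apply: cvgM; [exact: cvg_cst|exact: (cqC s)].
exists (fun s => x + c s *: (y - x)); split.
- by move=> s; apply: cvgD; [exact: cvg_cst | apply: cvgZr_tmp; exact: cc].
- by rewrite c0 scale0r addr0.
- by rewrite c1 scale1r addrC subrK.
move=> s _; rewrite pE pN0.
have [s0|s0] := eqVneq (s * (1 - s)) 0.
  have /orP[/eqP->|/eqP<-] : (s == 0) || (1 == s) by rewrite -(subr_eq0 1) -mulf_eq0 s0.
    by rewrite c0 -pN0 -px.
  by rewrite c1 -pN0 -py.
apply: contra rP => crs; apply/mapP; exists (c s) => //.
by rewrite cE /= /q mulfK.
Qed.

End Connected.

(** * Calculus of differentials along a fixed direction *)

Section DiffAlong.
Variables (K : numFieldType) (V : normedModType K).
Implicit Types (f g : V -> K) (x v : V) (a b : K).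

(** Bundling differentiability with the value of the differential lets one set of rules deliver
    both. *)
Definition diff_along f x v a := differentiable f x /\ 'd f x v = a.

Lemma diff_along_cst c x v : diff_along (fun=> c) x v 0.
Proof. by split; [exact: differentiable_cst | rewrite diff_cst]. Qed.

Lemma diff_alongD f g x v a b : diff_along f x v a -> diff_along g x v b ->
  diff_along (fun y => f y + g y) x v (a + b).
Proof.
by move=> [df <-] [dg <-]; split; [exact: differentiableD | rewrite (diffD df dg)].
Qed.

Lemma diff_alongM f g x v a b : diff_along f x v a -> diff_along g x v b ->
  diff_along (fun y => f y * g y) x v (f x * b + g x * a).
Proof.
by move=> [df <-] [dg <-]; split; [exact: differentiableM | rewrite (diffM df dg)].
Qed.

Lemma diff_alongV f x v a : diff_along f x v a -> f x != 0 ->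
  diff_along (fun y => (f y)^-1) x v (- (f x) ^- 2 * a).
Proof.
by move=> [df <-] f0; split; [exact: differentiableV | rewrite (diffV df f0)].
Qed.

Lemma diff_alongX f n x v a : diff_along f x v a ->
  diff_along (fun y => f y ^+ n) x v (n%:R * f x ^+ n.-1 * a).
Proof.
case: n => [_|n [df <-]]; first by rewrite !mul0r; exact: diff_along_cst.
have -> : (fun y => f y ^+ n.+1) = f ^+ n.+1 by rewrite exprfctE.
by split; [exact: differentiableX | rewrite (diffX n df)].
Qed.

(** Serves the factor x_1^(j-2) of [xi], whose exponent is -1 at j = 1. *)
Lemma diff_along_exprz f (z : int) x v a : diff_along f x v a -> f x != 0 ->
  diff_along (fun y => f y ^ z) x v (z%:~R * f x ^ (z - 1) * a).
Proof.
case: z => n fa f0.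
  have := diff_alongX n fa; congr diff_along; congr (_ * _).
  (* At exponent 0 the truncated [n.-1] differs from the integer -1, but the factor 0 makes both
     sides vanish. *)
  case: n => [|n]; first by rewrite !mul0r.
  by have -> : n.+1%:Z - 1 = n by lia.
have fn0 : f x ^+ n.+1 != 0 by rewrite expf_neq0.
have := diff_alongV (diff_alongX n.+1 fa) fn0; congr diff_along.
have -> : Negz n - 1 = - n.+2%:Z by lia.
rewrite NegzE mulrNz -exprnN /= !exprS.
have t0 : f x ^+ n != 0 by rewrite expf_neq0.
by move: (f x ^+ n) t0 => t t0; rewrite expr0 mulr1; field; rewrite f0 t0.
Qed.

Lemma diff_along_sum (I : Type) (r : seq I) (f : I -> V -> K) (a : I -> K) x v :
  (forall i, diff_along (f i) x v (a i)) ->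
  diff_along (fun y => \sum_(i <- r) f i y) x v (\sum_(i <- r) a i).
Proof.
move=> fa; elim: r => [|i r IHr].
  by under eq_fun do rewrite big_nil; rewrite big_nil; exact: diff_along_cst.
by under eq_fun do rewrite big_cons; rewrite big_cons; exact: diff_alongD.
Qed.

End DiffAlong.

Lemma diff_along_coord (K : numFieldType) (N : nat) (j : 'I_N) (x v : 'rV[K]_N) :
  diff_along (fun y : 'rV[K]_N => y 0 j) x v (v 0 j).
Proof.
split; first exact: differentiable_coord.
have @f : {linear 'rV[K]_N -> K}.
  by exists (fun y : 'rV[K]_N => y 0 j); do 2![eexists]; do ?[constructor];
     rewrite ?mxE// => ? *; rewrite ?mxE//; move=> ?; rewrite !mxE.
rewrite (_ : (fun _ => _) = f) // diff_lin //; exact: coord_continuous.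
Qed.

(** * Invariance of the Casimir functions under the coadjoint action *)

Section Invariance.
Variables (R : realType) (n : nat).
Local Notation C := (cplx R).
Implicit Types x v : 'rV[C]_n.+2.

(** It depends on x_1 and x_2 only, so [xi k] is affine in the other coordinates once these two are
    fixed. *)
Definition xi_coef (k j : nat) x : C :=
  (-1) ^+ (k - j) / ((k - j)`!)%:R
    * coord_at x 1 ^ (j%:Z - 2) * coord_at x 2 ^+ (k - j).

Lemma xiE k x : xi k x = \sum_(1 <= j < k.+1) xi_coef k j x * coord_at x j.
Proof. by []. Qed.

Lemma diff_along_xi k x v : coord_at x 1 != 0 ->
  diff_along (@xi C n k) x v (\sum_(1 <= j < k.+1) (-1) ^+ (k - j) / ((k - j)`!)%:R
    * (coord_at x 1 ^ (j%:Z - 2) * coord_at x 2 ^+ (k - j) * coord_at v j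
       + (j%:Z - 2)%:~R * coord_at x 1 ^ (j%:Z - 2 - 1) * coord_at v 1
         * coord_at x 2 ^+ (k - j) * coord_at x j
       + coord_at x 1 ^ (j%:Z - 2)
         * ((k - j)%:R * coord_at x 2 ^+ (k - j).-1 * coord_at v 2) * coord_at x j)).
Proof.
move=> x1; apply: diff_along_sum => j.
have c p := diff_along_coord (inord p.-1 : 'I_n.+2) x v.
have := diff_alongM (diff_alongM (diff_alongM
  (diff_along_cst ((-1) ^+ (k - j) / ((k - j)`!)%:R : C) x v)
  (diff_along_exprz (j%:Z - 2) (c 1) x1)) (diff_alongX (k - j) (c 2))) (c j).
rewrite -!/(coord_at _ _); congr diff_along; ring.
Qed.

(** Each monomial x_1^(j-2) x_2^(k-j) x_j has degree k - 1 and sum of indices 2(k - 1), so all of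
    them have the same weight (k - 1)(a + 2b). *)
Lemma diff_along_xi_scaling k x v a b : (2 <= k)%N -> coord_at x 1 != 0 ->
  (forall p, (1 <= p <= k)%N -> coord_at v p = (a + b * p%:R) * coord_at x p) ->
  diff_along (@xi C n k) x v ((k%:R - 1) * (a + 2%:R * b) * xi k x).
Proof.
move=> k2 x1 vE; have := diff_along_xi k v x1; congr diff_along.
rewrite xiE mulr_sumr; apply: eq_big_nat => j hj.
rewrite !vE ?hj //; try lia.
have -> : coord_at x 1 ^ (j%:Z - 2) = coord_at x 1 ^ (j%:Z - 2 - 1) * coord_at x 1.
  by rewrite -{3}[coord_at x 1]expr1z -expfzDr // subrK.
(* At j = k the exponent [(k - j).-1] is truncated, but the factor k - j is then 0. *)
have e : ((k - j)%:R : C) * coord_at x 2 ^+ (k - j).-1 * coord_at x 2 =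
    (k - j)%:R * coord_at x 2 ^+ (k - j).
  by case: (k - j)%N => [|m]; rewrite ?mul0r // -mulrA -exprSr.
have -> : forall t s, t * ((k - j)%:R * coord_at x 2 ^+ (k - j).-1 * (s * coord_at x 2))
    = t * s * ((k - j)%:R * coord_at x 2 ^+ (k - j)).
  by move=> t s; rewrite -e; ring.
rewrite /xi_coef natrB; last lia.
have -> : coord_at x 1 ^ (j%:Z - 2) = coord_at x 1 ^ (j%:Z - 2 - 1) * coord_at x 1.
  by rewrite -{3}[coord_at x 1]expr1z -expfzDr // subrK.
rewrite rmorphB /=; ring.
Qed.

(* Term j of the derivative in x_2 cancels term j + 1 of the derivative in the
   last factor. *)
Lemma diff_along_xi_shift k x v : (2 <= k)%N -> coord_at x 1 != 0 ->
  coord_at v 1 = 0 ->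
  (forall p, (2 <= p <= k)%N -> coord_at v p = - coord_at x p.-1) ->
  diff_along (@xi C n k) x v 0.
Proof.
move=> k2 x1 v1 vE; have := diff_along_xi k v x1; congr diff_along.
have v2 : coord_at v 2 = - coord_at x 1 by exact: (vE 2%N).
rewrite v2 v1.
under eq_bigr do rewrite mulr0 !mul0r addr0 mulrDr.
(* The two unpaired boundary terms vanish: j = 1 in the first sum carries v_1 = 0, and j = k in the
   second carries k - j = 0. *)
rewrite big_split /= big_nat_recl; last lia.
rewrite (v1 : coord_at v 1%N = 0) mulr0 mulr0 add0r.
rewrite [X in _ + X]big_nat_recr /=; last lia.
rewrite subnn !mul0r mulr0 mul0r mulr0 addr0 -big_split /=.
rewrite big_nat big1 // => j hj; rewrite vE /=; last lia.
have -> : (k - j = (k - j.+1).+1)%N by lia.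
set m := (k - j.+1)%N; rewrite /= factS natrM exprS.
have -> : (j.+1%:Z - 2 = (j%:Z - 2) + 1) by rewrite -natr1 /=; lia.
rewrite expfzDr // expr1z.
have m0 : m.+1%:R != 0 :> C by rewrite pnatr_eq0.
have m1 : m`!%:R != 0 :> C by rewrite pnatr_eq0 -lt0n fact_gt0.
by field; rewrite m1 nat1r m0.
Qed.

(** Numerator and denominator both have logarithmic weight 2(k - 1) [l]. The value [l] = 0 covers
    the direction of e_n. *)
Lemma diff_along_casimir k x v l : (2 <= k)%N -> s4_dom x ->
  diff_along (@xi C n 3) x v ((3%:R - 1) * l * xi 3 x) ->
  diff_along (@xi C n k) x v ((k%:R - 1) * l * xi k x) ->
  diff_along (@s4_casimir C n k) x v 0.
Proof.
move=> k2 [x1 x3] d3 dk.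
have x3k : xi 3 x ^+ (k - 1) != 0 by rewrite expf_neq0.
have := diff_alongM (diff_alongX 2 dk) (diff_alongV (diff_alongX (k - 1) d3) x3k).
congr diff_along; rewrite natrB; last lia.
have [m ->] : exists m, k = m.+2 by exists (k - 2)%N; lia.
rewrite !subn1 /= expr1 !(exprS _ m) -[m.+2%:R]natr1 -[m.+1%:R]natr1.
have : xi 3 x ^+ m != 0 by rewrite expf_neq0.
move: (xi 3 x ^+ m) => t t0; move: (xi 3 x) (xi m.+2 x) x3 => X Y X0.
by field; rewrite X0 t0.
Qed.

Lemma s4_casimir_along k (x : 'rV[C]_n.+2) (i : 'I_n.+2) : (4 <= n)%N -> (4 <= k < n)%N ->
  s4_dom x -> diff_along (@s4_casimir C n k) x (row i (coadjoint_mx (s4 C n) x)) 0.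
Proof.
move=> n4 kn xU; have [x1 _] := xU; set v := row _ _.
(* The coadjoint vector of e_{i+1}, computed only in the coordinates x_1, ..., x_{n-1} on which the
   Casimirs depend. *)
have vE q : (1 <= q < n)%N -> coord_at v q =
    if (i.+1 == n)%N then - (if (2 <= q)%N then coord_at x q.-1 else 0)
    else if (i.+1 == n.+1)%N then - ((n%:R - q%:R - 1) * coord_at x q)
    else if (i.+1 == n.+2)%N then - coord_at x q else 0.
  move=> hq; rewrite /coord_at 2!mxE s4_coadjointE !dot_s4_rel inordK; last lia.
  rewrite prednK; last lia.
  have <- : (n - q - 1)%N%:R = n%:R - q%:R - 1 :> C by rewrite !natrB //; lia.
  have hi := ltn_ord i.
  repeat (case: ifP => ?; try (exfalso; lia)); rewrite ?sub0r ?subr0 ?oppr0 //.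
case: (eqVneq i.+1 n) vE => [_|_] vE.
  have v1 : coord_at v 1 = 0 by rewrite (vE 1%N) ?oppr0 //; lia.
  have v2 p : (2 <= p < n)%N -> coord_at v p = - coord_at x p.-1.
    by move=> hp; rewrite vE ?ifT //; lia.
  apply: (@diff_along_casimir _ _ _ 0); rewrite ?mulr0 ?mul0r //; first lia.
    by apply: diff_along_xi_shift => // p hp; apply: v2; lia.
  by apply: diff_along_xi_shift => //; [lia | move=> p hp; apply: v2; lia].
(* The remaining vectors scale x_p by a weight affine in p: p + 1 - n for e_{n+1}, -1 for e_{n+2},
   and 0 for the abelian ideal. *)
suff [a [b vab]] : exists a b : C, forall p, (1 <= p < n)%N ->
    coord_at v p = (a + b * p%:R) * coord_at x p.
  by apply: (@diff_along_casimir _ _ _ (a + 2%:R * b)) => //; first lia;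
    apply: diff_along_xi_scaling => //;
      [move=> p hp; apply: vab; lia | lia | move=> p hp; apply: vab; lia].
case: (eqVneq i.+1 n.+1) vE => [_|_] vE.
  by exists (1 - n%:R), 1 => p hp; rewrite vE //; ring.
case: (eqVneq i.+1 n.+2) vE => [_|_] vE.
  by exists (-1), 0 => p hp; rewrite vE //; ring.
by exists 0, 0 => p hp; rewrite vE //; ring.
Qed.

Lemma s4_casimir_invariant k : (4 <= n)%N -> (4 <= k < n)%N -> open (@s4_dom C n) ->
  coadjoint_invariant (s4 C n) (@s4_dom C n) (@s4_casimir C n k).
Proof.
move=> n4 kn oU; have diffF x : s4_dom x -> differentiable (@s4_casimir C n k) x.
  by move=> xU; have [] := s4_casimir_along ord0 n4 kn xU.
split=> // x xU i; have [dF dF0] := s4_casimir_along i n4 kn xU.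
(* By linearity, the sum of partial derivatives is the differential applied to row i. *)
rewrite -[RHS]dF0 [X in 'd _ x X]row_sum_delta linear_sum; apply: eq_bigr => j _.
by rewrite linearZ /= deriveE ?mxE //; exact: diffF.
Qed.

End Invariance.

(** * A square root continuous at one prescribed point *)

Section SquareRoot.
Variable R : realType.
Local Notation C := (cplx R).

(** The root of [w] nearest to [c]. No branch is continuous everywhere, but this one is continuous
    at [c ^+ 2], which is all a section through one point requires. *)
Definition sqrt_near (c w : C) : C :=
  if `|sqrtC w - c| <= `|sqrtC w + c| then sqrtC w else - sqrtC w.

Lemma sqrt_nearK c w : sqrt_near c w ^+ 2 = w.
Proof. by rewrite /sqrt_near; case: ifP; rewrite ?sqrrN sqrtCK. Qed.

(* The closest root s satisfies |s - c| <= |s + c|; in particular c = 0 needs no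
   separate treatment. *)
Lemma sqrt_near_dist c w : `|sqrt_near c w - c| ^+ 2 <= `|w - c ^+ 2|.
Proof.
have -> : w - c ^+ 2 = (sqrt_near c w - c) * (sqrt_near c w + c).
  by rewrite -subr_sqr sqrt_nearK.
rewrite normrM expr2 ler_wpM2l // /sqrt_near; case: ifP => // /negbT.
rewrite -real_ltNge ?normr_real // => /ltW.
by rewrite -opprD normrN [- _ + c]addrC -opprB normrN.
Qed.

Lemma sqrt_near_cvg c : sqrt_near c w @[w --> c ^+ 2] --> c.
Proof.
apply/(@cvgrPdist_lt C C C (nbhs (c ^+ 2)) (nbhs_filter _) (sqrt_near c) c) => e e0.
have : \forall w \near c ^+ 2, `|c ^+ 2 - w| < e ^+ 2.
  by apply: nbhsx_ballx; rewrite exprn_gt0.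
move=> H; apply: (@filterS _ (nbhs (c ^+ 2)) _ _ _ _ H) => w hw.
rewrite -(@ltr_pXn2r _ 2) ?nnegrE ?normr_ge0 ?(ltW e0) //.
by apply: le_lt_trans hw; rewrite distrC [leRHS]distrC sqrt_near_dist.
Qed.

End SquareRoot.

Lemma cvg_rV (T : Type) (V : topologicalType) (F : set_system T) (FF : Filter F) (N : nat)
    (f : T -> 'rV[V]_N) (l : 'rV[V]_N) :
  (forall j, f t 0 j @[t --> F] --> l 0 j) -> f @ F --> l.
Proof.
move=> fl A [P Pl PA]; rewrite /= /nbhs /=.
have : \forall t \near F, forall j, P 0 j (f t 0 j).
  by apply: filter_forall => j; apply: fl; apply: Pl.
by apply: filterS => t Pt; apply: PA => i j; rewrite ord1.
Qed.

(** * Functional independence by means of sections *)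

Section Independence.
Variable R : realType.
Local Notation C := (cplx R).

Lemma functionally_independent_section (N m : nat) (U : set 'rV[C]_N)
    (F : 'I_m -> 'rV[C]_N -> C) :
  (forall x, U x -> exists G : 'rV[C]_m -> 'rV[C]_N,
     (forall z, \row_i F i (G z) = z) /\ G z @[z --> \row_i F i x] --> x) ->
  functionally_independent U F.
Proof.
move=> sec W oW [x Wx] WU [V [Phi [_ PhiN0 WPhi]]].
have [G [GK Gx]] := sec x (WU x Wx).
have nG : nbhs (\row_i F i x) (G @^-1` W) by apply: Gx; exact: open_nbhs_nbhs.
have sG : (G @^-1` W)° `<=` G @^-1` W by exact: interior_subset.
have [||z /sG Wz] := PhiN0 (G @^-1` W)° (open_interior _).
- by exists (\row_i F i x).
- by move=> z /sG /WPhi[]; rewrite GK.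
by have [_] := WPhi _ Wz; rewrite GK => ->; rewrite eqxx.
Qed.

Variable n : nat.

(** A displacement of x_4, ..., x_{n-1} alone; the 0-based index i stands for the label i + 4. *)
Definition s4_tail (w : 'rV[C]_(n - 4)) : 'rV[C]_n.+2 :=
  \sum_i w 0 i *: basis_elt C n (i + 4).

Lemma coord_s4_tail w p : (1 <= p <= n.+2)%N ->
  coord_at (s4_tail w) p = \sum_i w 0 i * (p == i + 4)%N%:R.
Proof.
move=> hp; rewrite /coord_at summxE; apply: eq_bigr => i _; rewrite !mxE eqxx /=.
congr (_ * (nat_of_bool _)%:R); rewrite -val_eqE /= !inordK; have := ltn_ord i; lia.
Qed.

Lemma coordD (x y : 'rV[C]_n.+2) p : coord_at (x + y) p = coord_at x p + coord_at y p.
Proof. by rewrite /coord_at mxE. Qed.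

Lemma coord_s4_tail0 w p : (4 <= n)%N -> (1 <= p <= 3)%N -> coord_at (s4_tail w) p = 0.
Proof.
move=> n4 hp; rewrite coord_s4_tail; last lia.
by apply: big1 => i _; rewrite (_ : (p == i + 4)%N = false) ?mulr0 //; lia.
Qed.

Lemma xi_add_tail k x w : (4 <= n)%N -> (k < n)%N ->
  xi k (x + s4_tail w) =
  xi k x + \sum_i w 0 i * (if (i + 4 <= k)%N then xi_coef k (i + 4) x else 0).
Proof.
move=> n4 kn; rewrite !xiE.
have cE j : xi_coef k j (x + s4_tail w) = xi_coef k j x.
  by rewrite /xi_coef !coordD !coord_s4_tail0 ?addr0 //.
under eq_bigr do rewrite cE coordD mulrDr.
rewrite big_split /=; congr (_ + _).
transitivity (\sum_(1 <= j < k.+1) \sum_i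
    xi_coef k j x * (w 0 i * (j == i + 4)%N%:R)).
  by apply: eq_big_nat => j hj; rewrite coord_s4_tail ?mulr_sumr //; lia.
rewrite exchange_big /=; apply: eq_bigr => i _.
case: ifP => ik.
  rewrite (bigD1_seq (i + 4)%N) /=; [|by rewrite mem_index_iota; lia|exact: iota_uniq].
  rewrite eqxx mulr1 mulrC big1 ?addr0 // => j /negPf ->.
  by rewrite mulr0 mulr0.
rewrite mulr0 big_nat big1 // => j hj.
by rewrite (_ : (j == i + 4)%N = false) ?mulr0 //; lia.
Qed.

Lemma cvg_add_tail (T : Type) (F : set_system T) (FF : Filter F)
    (s : T -> 'I_(n - 4) -> C) (c : 'I_(n - 4) -> C) (x : 'rV[C]_n.+2) (B : 'M[C]_(n - 4)) :
  (forall i, s t i @[t --> F] --> c i) ->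
  x + s4_tail ((\row_i (s t i - c i)) *m B) @[t --> F] --> x.
Proof.
move=> sc; apply: cvg_rV => j.
have -> : (fun t => (x + s4_tail ((\row_i (s t i - c i)) *m B)) 0 j) =
    (fun t => x 0 j + \sum_i \sum_l (s t l - c l) * (B l i * basis_elt C n (i + 4) 0 j)).
  apply/funext => t; rewrite mxE summxE; congr (_ + _); apply: eq_bigr => i _.
  by rewrite !mxE mulr_suml; apply: eq_bigr => l _; rewrite !mxE mulrA.
have sum0 (I : finType) (f : I -> T -> C) :
    (forall i, f i t @[t --> F] --> 0) -> \sum_i f i t @[t --> F] --> (0 : C).
  move=> f0; have := @cvg_big C I +%R 0 xpredT add_continuous T F (index_enum I) f
    (fun=> 0) FF (fun i _ => f0 i).
  by rewrite big1.
have Ft i l : (s t l - c l) * (B l i * basis_elt C n (i + 4) 0 j) @[t --> F] --> (0 : C).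
  have := cvgM (cvgB (sc l) (cvg_cst (c l)))
    (cvg_cst (B l i * basis_elt C n (i + 4) 0 j)).
  by rewrite subrr mul0r; apply.
have := cvgD (cvg_cst (x 0 j)) (sum0 _ _ (fun i => sum0 _ _ (Ft i))).
by rewrite addr0; apply.
Qed.

(** Acting on row vectors, it sends a displacement of (x_4, ..., x_{n-1}) to the resulting change of
    (xi_4, ..., xi_{n-1}). *)
Definition xi_mx (x : 'rV[C]_n.+2) : 'M[C]_(n - 4) :=
  \matrix_(i, l) (if (i <= l)%N then xi_coef (l + 4) (i + 4) x else 0).

(** The matrix is upper triangular with diagonal entries x_1^(i+2). *)
Lemma xi_mx_unit x : coord_at x 1 != 0 -> xi_mx x \in unitmx.
Proof.
move=> x1; rewrite unitmxE -det_tr det_trig.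
  rewrite unitfE; apply/prodf_neq0 => i _.
  by rewrite !mxE leqnn /xi_coef subnn !expr0 divr1 mul1r mulr1 expfz_neq0.
by apply/is_trig_mxP => i j ij; rewrite !mxE leqNgt ij.
Qed.

(** Keeping x_1, x_2, x_3 keeps xi_3. Each xi_{i+4} must then become a square root of z_i
    xi_3^(i+3); the root nearest to its value at [x] is taken, and inverting [xi_mx x] gives the
    displacement that produces it. *)
Lemma s4_casimir_section (x : 'rV[C]_n.+2) : (4 <= n)%N -> s4_dom x ->
  exists G : 'rV[C]_(n - 4) -> 'rV[C]_n.+2,
  (forall z, \row_(i < n - 4) s4_casimir (i + 4) (G z) = z) /\
  G z @[z --> (\row_(i < n - 4) s4_casimir (i + 4) x : 'rV[C]_(n - 4))] --> x.
Proof.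
move=> n4 [x1 x3]; pose z0 : 'rV[C]_(n - 4) := \row_i s4_casimir (i + 4) x.
pose s (z : 'rV[C]_(n - 4)) (i : 'I_(n - 4)) :=
  sqrt_near (xi (i + 4) x) (z 0 i * xi 3 x ^+ (i + 4 - 1)).
pose eta z := \row_i (s z i - xi (i + 4) x).
pose B := invmx (xi_mx x).
exists (fun z => x + s4_tail (eta z *m B)); split=> [z|].
  apply/rowP => i; rewrite mxE /s4_casimir.
  rewrite [xi 3 _]xi_add_tail //.
  rewrite [X in _ / (_ + X) ^+ _]big1 ?addr0 => [|l _]; last first.
    by rewrite (_ : (l + 4 <= 3)%N = false) ?mulr0 // leqNgt ltn_addl.
  rewrite xi_add_tail //; last by have := ltn_ord i; lia.
  rewrite [X in (_ + X) ^+ 2](_ : _ = eta z 0 i).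
    rewrite mxE [_ + (_ - _)]addrC subrK sqrt_nearK mulfK //.
    by rewrite expf_neq0.
  transitivity ((eta z *m B *m xi_mx x) 0 i); last by rewrite mulmxKV // xi_mx_unit.
  by rewrite mxE; apply: eq_bigr => l _; rewrite !mxE leq_add2r.
(* At [z0] the number under the root is exactly the square of xi_{i+4} at [x], the point where
   [sqrt_near] is continuous. *)
have sc i : s z i @[z --> z0] --> xi (i + 4) x.
  have e : z0 0 i * xi 3 x ^+ (i + 4 - 1) = xi (i + 4) x ^+ 2.
    by rewrite mxE mulfVK // expf_neq0.
  have cm : continuous (fun z : 'rV[C]_(n - 4) => z 0 i * xi 3 x ^+ (i + 4 - 1)).
    move=> z; apply: differentiable_continuous.
    by apply: differentiableM; [exact: differentiable_coord | exact: differentiable_cst].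
  have cs : sqrt_near (xi (i + 4) x) w @[w --> z0 0 i * xi 3 x ^+ (i + 4 - 1)]
      --> xi (i + 4) x by rewrite e; exact: sqrt_near_cvg.
  exact: (cvg_comp _ _ (cm z0) cs).
exact: (@cvg_add_tail _ _ (nbhs_filter z0) s (fun i => xi (i + 4) x) x B sc).
Qed.

End Independence.

(** * The domain is open, connected and nonempty *)

Section Domain.
Variables (R : realType) (n : nat).
Local Notation C := (cplx R).
Implicit Types x : 'rV[C]_n.+2.

(** This is x_1 xi_3 where x_1 is nonzero: the negative power in the first term of xi_3 cancels
    against its factor x_1. *)
Definition s4_dom_poly x : C :=
  coord_at x 1 * (coord_at x 1 * coord_at x 3 - coord_at x 2 ^+ 2 / 2%:R).

Lemma s4_domE : @s4_dom C n = [set x | s4_dom_poly x != 0].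
Proof.
have xi3E x : coord_at x 1 != 0 ->
    xi 3 x = coord_at x 1 * coord_at x 3 - coord_at x 2 ^+ 2 / 2%:R.
  move=> x1; rewrite /xi 3?big_ltn // big_geq // addr0.
  rewrite (_ : 3 - 1 = 2)%N // (_ : 3 - 2 = 1)%N // (_ : 3 - 3 = 0)%N //.
  rewrite (_ : 2`! = 2)%N // (_ : 1`! = 1)%N // fact0.
  rewrite (_ : 1%:Z - 2 = -1) // (_ : 2%:Z - 2 = 0) // (_ : 3%:Z - 2 = 1) //.
  rewrite !(exprN1, expr0z, expr1z) !(expr0, expr1).
  by field; rewrite x1.
apply/seteqP; split=> x /=; rewrite /s4_dom_poly mulf_eq0 negb_or.
  by case=> x1 x3; rewrite x1 -xi3E.
by case/andP=> x1; rewrite -xi3E.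
Qed.

Lemma open_s4_dom : open (@s4_dom C n).
Proof.
rewrite s4_domE; apply: (@open_comp _ _ _ [set z : C | z != 0]).
  move=> x _; apply: differentiable_continuous.
  have c p := diff_along_coord (inord p.-1 : 'I_n.+2) x 0.
  apply: differentiableM; first exact: (c 1%N).1.
  apply: differentiableB; first by apply: differentiableM; [exact: (c 1%N).1 | exact: (c 3).1].
  exact: (diff_alongM (diff_alongX 2 (c 2)) (diff_along_cst (2%:R^-1) x 0)).1.
have -> : [set z : C | z != 0] = ~` [set 0].
  by apply/seteqP; split=> z /= /eqP.
by apply: closed_openC; apply/accessible_closed_set1/hausdorff_accessible/norm_hausdorff.
Qed.

Lemma connected_s4_dom : connected (@s4_dom C n).
Proof.
rewrite s4_domE; apply: connected_nonzero_polynomial => x d.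
have [l lE] : exists l : nat -> {poly C},
    forall p t, (l p).[t] = coord_at (x + t *: d) p.
  exists (fun p => (coord_at x p)%:P + (coord_at d p) *: 'X) => p t.
  by rewrite !hornerE /coord_at !mxE mulrC.
exists (l 1 * (l 1 * l 3 - (2%:R^-1) *: l 2 ^+ 2)) => t.
by rewrite /s4_dom_poly !(hornerM, hornerD, hornerN, hornerZ, hornerXn, horner_exp) !lE; ring.
Qed.

Lemma s4_dom_nonempty : (0 < n)%N -> @s4_dom C n !=set0.
Proof.
move=> n0; exists (s4_generic_point C n); rewrite s4_domE /= /s4_dom_poly.
have e p : (0 < p <= 3)%N -> coord_at (s4_generic_point C n) p = (p != 2%N)%:R.
  by move=> hp; rewrite /coord_at mxE inordK; [congr (nat_of_bool _)%:R|]; lia.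
rewrite (e 1%N) // (e 2%N) // (e 3%N) //.
by rewrite !mul1r expr0n mul0r subr0 oner_neq0.
Qed.

End Domain.

Theorem mainTheorem10 (R : realType) (n : nat) (hn : (4 <= n)%N) :
  @invariant_basis R n.+2 (n - 4) (s4 (cplx R) n) (@s4_dom (cplx R) n)
    (fun (i : 'I_(n - 4)) (x : 'rV[cplx R]_n.+2) => s4_casimir (i + 4) x).
Proof.
split.
- by split; [exact: open_s4_dom | exact: connected_s4_dom | apply: s4_dom_nonempty; lia].
- by rewrite num_invariants_s4 // pnatr_eq0.
- move=> i; apply: s4_casimir_invariant => //; last exact: open_s4_dom.
  by have := ltn_ord i; lia.
- by apply: functionally_independent_section => x; exact: s4_casimir_section.
Qed.
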